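(* For every real $\epsilon>0$ and every integer $r\ge 1$ there is a real $\delta>0$ such that the following holds. Let $G$ be an $r$-graph and let $x\ge r$ be a real number with $|G|=\binom{x}{r}$. If $K^r_{r+1}(G)>(1-\delta)\binom{x}{r+1}$, then there is a set $S\subset V(G)$ of $\lceil x\rceil$ vertices such that all but at most $\epsilon\binom{x}{r}$ edges of $G$ are contained in $S$.
   Context: An $r$-graph $G$ consists of a finite vertex set $V(G)$ and a set $E(G)$ of edges, each edge being an $r$-element subset of $V(G)$; $|G|=|E(G)|$. $K^r_{r+1}(G)$ denotes the number of copies of $K^r_{r+1}$ in $G$, i.e. the number of $(r+1)$-element subsets of $V(G)$ all of whose $r$-element subsets are edges of $G$. For real $x$ and integer $k\ge 0$, $\binom{x}{k}=x(x-1)\cdots(x-k+1)/k!$. *)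

(* Defs.v *)
From mathcomp Require Import all_boot all_order all_algebra.
From mathcomp Require Import reals.

Set Implicit Arguments.
Unset Strict Implicit.
Unset Printing Implicit Defensive.

Import Order.TTheory GRing.Theory Num.Theory.
Local Open Scope ring_scope.

Record uniform_hypergraph (r : nat) := UniformHypergraph {
  vertex : finType;
  edges : {set {set vertex}};
  edges_card : forall e, e \in edges -> #|e| = r
}.

(* The copies of the complete r-graph on s vertices, identified with their vertex sets. *)
Definition cliques (r s : nat) (G : uniform_hypergraph r) : {set {set vertex G}} :=
  [set K : {set vertex G} | (#|K| == s) &&
    [forall e : {set vertex G}, (e \subset K) && (#|e| == r) ==> (e \in edges G)]].

(* The generalized binomial coefficient x (x - 1) ... (x - k + 1) / k! *)
Definition rbinom (R : realType) (x : R) (k : nat) : R :=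
  (\prod_(i < k) (x - i%:R)) / (k`!)%:R.

(* Main.v *)
(* Write d v for the degree of v and k v for the number of copies of K^r_(r+1)
   through v. Such copies give copies of K^(r-1)_r in the link of v, and also edges
   avoiding v; according as d v is below or above b = C(x-1,r-1), the first or
   the second observation gives r k v <= (x - r) d v (with induction on r for
   the first), which sums to Lovasz' bound.
   For stability with delta = eta^2, let A be the set of vertices with
   r k v > (1 - eta) (x - r) d v. By Markov, the degrees outside A sum to at
   most eta r |G|, and for v in A the two observations above force
   (1 - eta)^(r-1) b <= d v <= b / (1 - eta). Since r |G| = x b, A has at most
   x / (1 - eta)^(r-1) vertices, so cutting A down to the ceiling of x vertices
   loses few edges. *)
Require Import Defs.
From mathcomp Require Import all_boot all_order all_algebra.
From mathcomp Require Import reals.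
From mathcomp Require Import ring lra.

Set Implicit Arguments.
Unset Strict Implicit.
Unset Printing Implicit Defensive.

Import Order.TTheory GRing.Theory Num.Theory.
Local Open Scope ring_scope.

(** * Binomial coefficients with real upper argument *)

Section Binomial.
Variable R : realType.
Implicit Types x y c : R.

Lemma rbinomS_pred x k : k.+1%:R * rbinom x k.+1 = x * rbinom (x - 1) k.
Proof.
rewrite /rbinom big_ord_recl subr0 factS natrM.
have -> : \prod_(i < k) (x - (lift ord0 i)%:R) = \prod_(i < k) (x - 1 - i%:R).
  by apply: eq_bigr => i _; rewrite /= /bump /= natrD opprD addrA.
have k1 : k.+1%:R != 0 :> R by rewrite pnatr_eq0.
have kf : (k`!)%:R != 0 :> R by rewrite pnatr_eq0 -lt0n fact_gt0.
by move: k.+1%:R k1 kf => a a0 f0; field; rewrite a0 f0.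
Qed.

Lemma rbinomS x k : k.+1%:R * rbinom x k.+1 = (x - k%:R) * rbinom x k.
Proof.
rewrite /rbinom big_ord_recr /= factS natrM.
have k1 : k.+1%:R != 0 :> R by rewrite pnatr_eq0.
have kf : (k`!)%:R != 0 :> R by rewrite pnatr_eq0 -lt0n fact_gt0.
by move: k.+1%:R k1 kf => a a0 f0; field; rewrite a0 f0.
Qed.

Lemma rbinom_natr n k : rbinom (n%:R : R) k = 'C(n, k)%:R.
Proof.
elim: k n => [|k IHk] n; first by rewrite /rbinom big_ord0 divr1 bin0.
have k1 : k.+1%:R != 0 :> R by rewrite pnatr_eq0.
apply: (mulfI k1); rewrite rbinomS IHk -natrM mul_bin_left natrM.
have [kn|nk] := leqP k n; first by rewrite natrB.
by rewrite bin_small ?mulr0.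
Qed.

Lemma rbinom_gt0 x k : k%:R <= x -> 0 < rbinom x k.
Proof.
move=> kx; rewrite /rbinom divr_gt0 ?ltr0n ?fact_gt0 //.
apply: prodr_gt0 => i _; rewrite subr_gt0.
by apply: lt_le_trans kx; rewrite ltr_nat.
Qed.

Lemma ler_rbinom_scale c x y k : 0 <= c -> k%:R <= x ->
  (forall i, (i < k)%N -> c * (x - i%:R) <= y - i%:R) ->
  c ^+ k * rbinom x k <= rbinom y k.
Proof.
move=> c0 kx cxy; rewrite /rbinom mulrA ler_wpM2r ?invr_ge0 //.
have -> : c ^+ k = \prod_(i < k) c by rewrite prodr_const card_ord.
rewrite -big_split /=; apply: ler_prod => i _; rewrite cxy // andbT.
by rewrite mulr_ge0 // subr_ge0 (le_trans _ kx) // ler_nat ltnW.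
Qed.

(** Strictness comes from the leading factor [x < y] alone; the remaining factors are compared
    weakly, by [ler_rbinom_scale] with [c = 1]. *)
Lemma ltr_rbinom x y k : k.+1%:R <= x -> x < y -> rbinom x k.+1 < rbinom y k.+1.
Proof.
move=> kx xy; have k0 : 0 < k.+1%:R :> R by rewrite ltr0n.
have kx1 : k%:R <= x - 1 by rewrite -natr1 in kx; lra.
rewrite -(ltr_pM2l k0) !rbinomS_pred.
have := @ler_rbinom_scale 1 (x - 1) (y - 1) k ler01 kx1.
rewrite expr1n mul1r => le_xy.
apply: (@lt_le_trans _ _ (y * rbinom (x - 1) k)); first by rewrite ltr_pM2r // rbinom_gt0.
rewrite ler_wpM2l ?le_xy //; first by have := ler0n R k; lra.
by move=> i _; lra.
Qed.

Lemma Bernoulli_sub1 c n : 0 <= c -> c <= 1 -> 1 - n%:R * c <= (1 - c) ^+ n.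
Proof.
move=> c0 c1; elim: n => [|n IHn]; first by rewrite mul0r subr0 expr0.
rewrite exprS -natr1; apply: (@le_trans _ _ ((1 - c) * (1 - n%:R * c))).
  by have := ler0n R n; nra.
by rewrite ler_wpM2l // subr_ge0.
Qed.

End Binomial.

(** * Stars, links and cliques in finite set systems *)

Section SetSystems.
Variable T : finType.
Implicit Types (E F : {set {set T}}) (v : T) (S : {set T}).

Definition star E v := [set e in E | v \in e].

Definition link E v := [set f : {set T} | (v \notin f) && (v |: f \in E)].

(** Here [s] is the edge size, so [cliques r.+1 G] unfolds to [clique_sets r (edges G)]. *)
Definition clique_sets s E : {set {set T}} :=
  [set K : {set T} | (#|K| == s.+1) &&
    [forall e : {set T}, (e \subset K) && (#|e| == s) ==> (e \in E)]].

Lemma sum_card_star E k : (forall e, e \in E -> #|e| = k) ->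
  (\sum_v #|star E v| = k * #|E|)%N.
Proof.
move=> Ek; transitivity (\sum_v \sum_(e in E) (v \in e : nat))%N.
  apply: eq_bigr => v _; rewrite -sum1_card big_mkcond [RHS]big_mkcond.
  by apply: eq_bigr => e _; rewrite inE; case: (e \in E); case: (v \in e).
rewrite exchange_big /= mulnC -sum_nat_const; apply: congr_big => // e eE.
by rewrite -(Ek e eE) -sum1_card [RHS]big_mkcond; apply: eq_bigr => v _; case: (v \in e).
Qed.

Lemma setD1_inj_star v : {in [pred e : {set T} | v \in e] &, injective (fun e => e :\ v)}.
Proof. by move=> e f /= ve vf ef; rewrite -(setD1K ve) ef setD1K. Qed.

Lemma card_link E v : #|link E v| = #|star E v|.
Proof.
have <- : [set e :\ v | e in star E v] = link E v.
  apply/setP=> f; rewrite inE; apply/imsetP/andP => [[e] | [vf fE]].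
    by rewrite inE => /andP[eE ve] ->; rewrite setD11 setD1K.
  by exists (v |: f); [rewrite inE fE setU11 | rewrite setU1K].
apply: card_in_imset => e f; rewrite !inE => /andP[_ ve] /andP[_ vf].
exact: setD1_inj_star.
Qed.

Lemma link_uniform s E v : (forall e, e \in E -> #|e| = s.+1) ->
  forall f, f \in link E v -> #|f| = s.
Proof. by move=> Es f; rewrite inE => /andP[vf /Es]; rewrite cardsU1 vf => -[]. Qed.

Lemma clique_setsP s E (K : {set T}) : reflect
  (#|K| = s.+1 /\ forall e : {set T}, e \subset K -> #|e| = s -> e \in E)
  (K \in clique_sets s E).
Proof.
rewrite inE; apply: (iffP andP) => [[/eqP-> /forallP EK]|[-> EK]]; split => //.
  by move=> e eK es; apply: (implyP (EK e)); rewrite eK es eqxx.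
by apply/forallP=> e; apply/implyP=> /andP[eK /eqP es]; apply: EK.
Qed.

(** Deleting [v] is injective on cliques [K] through [v]. If [f] is an [s]-subset of [K :\ v], then
    [v |: f] is an edge inside [K], so [f] lies in the link. *)
Lemma card_star_clique_le_link s E v :
  (#|star (clique_sets s.+1 E) v| <= #|clique_sets s (link E v)|)%N.
Proof.
have inj : {in star (clique_sets s.+1 E) v &, injective (fun K => K :\ v)}.
  by move=> e f; rewrite !inE => /andP[_ ve] /andP[_ vf]; apply: setD1_inj_star.
rewrite -(card_in_imset inj); apply: subset_leq_card.
apply/subsetP=> _ /imsetP[K KE ->].
move: KE; rewrite inE => /andP[/clique_setsP[Ks EK] vK].
apply/clique_setsP; split; first by move: Ks; rewrite (cardsD1 v) vK => -[].
move=> f; rewrite subsetD1 => /andP[fK vf] fs; rewrite inE vf /=.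
by apply: EK; rewrite ?subUset ?sub1set ?vK // cardsU1 vf fs.
Qed.

(** [K :\ v] is an edge avoiding [v], so cliques through [v] inject into [E] minus the star. *)
Lemma card_star_clique_star s E v :
  (#|star (clique_sets s E) v| + #|star E v| <= #|E|)%N.
Proof.
have inj : {in star (clique_sets s E) v &, injective (fun K => K :\ v)}.
  by move=> e f; rewrite !inE => /andP[_ ve] /andP[_ vf]; apply: setD1_inj_star.
rewrite -(card_in_imset inj) -(cardsID (star E v) E) addnC leq_add //.
  by apply: subset_leq_card; apply/subsetP=> e; rewrite !inE => /andP[-> ->].
apply: subset_leq_card; apply/subsetP=> _ /imsetP[K KE ->].
move: KE; rewrite inE => /andP[/clique_setsP[Ks EK] vK].
have KvE : K :\ v \in E.
  by apply: EK; rewrite ?subsetDl //; move: Ks; rewrite (cardsD1 v) vK => -[].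
by rewrite in_setD KvE inE setD11 andbF.
Qed.

Lemma card_edges_not_subset_le E S :
  (#|[set e in E | ~~ (e \subset S)]| <= \sum_(v | v \notin S) #|star E v|)%N.
Proof.
apply: (@leq_trans #|\bigcup_(v | v \notin S) star E v|); last first.
  elim/big_rec2: _ => [|v n U _ IH]; first by rewrite cards0.
  by rewrite (leq_trans (leq_card_setU _ _)) // leq_add2l.
apply: subset_leq_card; apply/subsetP=> e; rewrite inE => /andP[eE /subsetPn[v ve vS]].
by apply/bigcupP; exists v => //; rewrite inE eE.
Qed.

Lemma exists_comparable_set (A : {set T}) k : (k <= #|T|)%N ->
  exists2 S : {set T}, #|S| = k & S \subset A \/ A \subset S.
Proof.
have draw (B : {set T}) m : (m <= #|B|)%N -> exists2 S : {set T}, S \subset B & #|S| = m.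
  move=> mB; have /card_gt0P[S] : (0 < #|[set S : {set T} | S \subset B & #|S| == m]|)%N.
    by rewrite cards_draws bin_gt0.
  by rewrite inE => /andP[SB /eqP Sm]; exists S.
move=> kT; have [/draw[S SA Sk]|Ak] := leqP k #|A|; first by exists S => //; left.
have /draw[S SA Sk] : (k - #|A| <= #|~: A|)%N by rewrite (cardsCs (~: A)) setCK leq_sub2r.
exists (A :|: S); last by right; apply: subsetUl.
rewrite cardsU disjoint_setI0 ?cards0 ?subn0 ?Sk ?subnKC 1?ltnW //.
by rewrite disjoint_sym disjoints_subset.
Qed.

End SetSystems.

(** * Lovasz' bound on the number of cliques *)

Section CliqueBound.
Variable R : realType.
Implicit Types x z eta : R.

Lemma natr_star_clique_le (T : finType) (E : {set {set T}}) s v :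
  #|star (clique_sets s E) v|%:R <= #|E|%:R - #|star E v|%:R :> R.
Proof. by rewrite lerBrDr -natrD ler_nat card_star_clique_star. Qed.

Lemma sum_starR (T : finType) (E : {set {set T}}) k :
  (forall e, e \in E -> #|e| = k) ->
  \sum_v #|star E v|%:R = k%:R * #|E|%:R :> R.
Proof. by move=> Ek; rewrite -natr_sum (sum_card_star Ek) natrM. Qed.

Lemma clique_sets_uniform (T : finType) (E : {set {set T}}) s (K : {set T}) :
  K \in clique_sets s E -> #|K| = s.+1.
Proof. by case/clique_setsP. Qed.

(* Lovasz' bound K <= C(z, s+1) for |E| = C(z, s), in a form that is linear in
   |E| and does not require |E| itself to be written as a binomial coefficient;
   the strict inequality makes it true for s = 0 as well. *)
Definition clique_bound s := forall (T : finType) (E : {set {set T}}) z,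
  s%:R <= z -> (forall e, e \in E -> #|e| = s) -> #|E|%:R < rbinom z s ->
  s.+1%:R * #|clique_sets s E|%:R <= (z - s%:R) * #|E|%:R.

Lemma star_clique_le_of_small_star s (T : finType) (E : {set {set T}}) z v :
  clique_bound s -> s.+1%:R <= z -> (forall e, e \in E -> #|e| = s.+1) ->
  #|star E v|%:R < rbinom (z - 1) s ->
  s.+1%:R * #|star (clique_sets s.+1 E) v|%:R <= (z - s.+1%:R) * #|star E v|%:R.
Proof.
move=> bound sz Es; rewrite -card_link => dlt.
have sz1 : s%:R <= z - 1 by rewrite -natr1 in sz; lra.
have -> : z - s.+1%:R = z - 1 - s%:R by rewrite -natr1; ring.
apply: le_trans (bound _ _ _ sz1 (link_uniform Es (v := v)) dlt).
by rewrite ler_wpM2l // ler_nat card_star_clique_le_link.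
Qed.

(** For a star of size at least [rbinom (z - 1) s], cliques are bounded by edges avoiding [v], and
    [s.+1%:R * rbinom z s.+1] equals [z * rbinom (z - 1) s]. The bound on [E] is weak so that
    stability can use it at equality. *)
Lemma star_clique_le s (T : finType) (E : {set {set T}}) z v :
  clique_bound s -> s.+1%:R <= z -> (forall e, e \in E -> #|e| = s.+1) ->
  #|E|%:R <= rbinom z s.+1 ->
  s.+1%:R * #|star (clique_sets s.+1 E) v|%:R <= (z - s.+1%:R) * #|star E v|%:R.
Proof.
move=> bound sz Es Ez.
have [|dge] := ltP #|star E v|%:R (rbinom (z - 1) s).
  exact: star_clique_le_of_small_star.
have s0 : 0 < s.+1%:R :> R by rewrite ltr0n.
apply: le_trans (ler_wpM2l (ltW s0) (natr_star_clique_le E s.+1 v)) _.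
rewrite mulrBr mulrBl lerB //.
apply: (@le_trans _ _ (s.+1%:R * rbinom z s.+1)); first by rewrite ler_pM2l.
by rewrite rbinomS_pred ler_wpM2l // (le_trans _ sz).
Qed.

Lemma clique_boundP s : clique_bound s.
Proof.
elim: s => [|s IHs] T E z sz Es Ez.
  (* Fewer than [rbinom z 0 = 1] edges means none; a clique would make [set0] an edge. *)
  have E0 : E = set0.
    apply: cards0_eq; move: Ez.
    by rewrite /rbinom big_ord0 divr1 (ltr_nat R _ 1) ltnS leqn0 => /eqP.
  rewrite E0 cards0 mulr0 mul1r.
  case: (set_0Vmem (clique_sets 0 (set0 : {set {set T}}))) => [->|[K /clique_setsP[_ /(_ set0)]]].
    by rewrite cards0.
  by rewrite sub0set cards0 inE => /(_ isT erefl).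
have s0 : 0 < s.+1%:R :> R by rewrite ltr0n.
rewrite -(sum_starR (@clique_sets_uniform _ E s.+1)) -(ler_pM2l s0) mulrCA -(sum_starR Es).
rewrite !mulr_sumr; apply: ler_sum => v _.
by apply: star_clique_le => //; apply: ltW.
Qed.

(** * Stability for a nearly extremal clique count *)

Section Stability.
Variables (s : nat) (T : finType) (E : {set {set T}}) (x eta : R).
Hypotheses (sx : s.+1%:R <= x) (Es : forall e, e \in E -> #|e| = s.+1).
Hypotheses (Ex : #|E|%:R = rbinom x s.+1).
Hypotheses (eta_gt0 : 0 < eta) (eta_small : s.+1%:R * eta <= 1 / 2).
Hypothesis many : (1 - eta ^+ 2) * rbinom x s.+2 < #|clique_sets s.+1 E|%:R.

Let d v : R := #|star E v|%:R.
Let k v : R := #|star (clique_sets s.+1 E) v|%:R.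
Let A := [set v | (1 - eta) * (x - s.+1%:R) * d v < s.+1%:R * k v].
Let b := rbinom (x - 1) s.

Let s0 : 0 < s.+1%:R :> R. Proof. by rewrite ltr0n. Qed.
Let s1 : 1 <= s.+1%:R :> R. Proof. by rewrite ler1n. Qed.
Let x0 : 0 < x. Proof. exact: lt_le_trans sx. Qed.
Let eta1 : eta <= 1 / 2.
Proof. by apply: le_trans eta_small; rewrite ler_peMl // ltW. Qed.
Let sx1 : s%:R <= x - 1. Proof. by move: sx; rewrite -natr1; lra. Qed.
Let b0 : 0 < b. Proof. exact: rbinom_gt0. Qed.
Let Eb : s.+1%:R * #|E|%:R = x * b. Proof. by rewrite Ex rbinomS_pred. Qed.

Let u : R := x - s.+1%:R.
Let u0 : 0 <= u. Proof. by rewrite subr_ge0. Qed.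

Lemma sum_star_bad : \sum_(v | v \notin A) d v <= eta * (s.+1%:R * #|E|%:R).
Proof.
have deficit_ge0 v : 0 <= u * d v - s.+1%:R * k v.
  by rewrite subr_ge0; apply: star_clique_le => //; [exact: clique_boundP | rewrite Ex].
have sumk : \sum_v k v = s.+2%:R * #|clique_sets s.+1 E|%:R.
  exact: sum_starR (@clique_sets_uniform _ E s.+1).
have sumd : \sum_v d v = s.+1%:R * #|E|%:R by exact: sum_starR.
have many' : (1 - eta ^+ 2) * (u * #|E|%:R) < s.+2%:R * #|clique_sets s.+1 E|%:R.
  by rewrite Ex -rbinomS mulrCA ltr_pM2l ?ltr0n.
have total : \sum_v (u * d v - s.+1%:R * k v) < eta ^+ 2 * u * (s.+1%:R * #|E|%:R).
  rewrite sumrB -!mulr_sumr sumk sumd.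
  by move: many'; rewrite -(ltr_pM2l s0); lra.
have bad : eta * u * \sum_(v | v \notin A) d v <= \sum_v (u * d v - s.+1%:R * k v).
  rewrite [leRHS](bigID (mem A)) /= mulr_sumr -[leLHS]add0r lerD ?sumr_ge0 //.
  apply: ler_sum => v; rewrite inE -leNgt -/u => vA.
  by move: vA; lra.
have lt := le_lt_trans bad total.
(* At [u = 0] both sides of [lt] vanish, so its strictness permits cancelling [u]. *)
have u_gt0 : 0 < u.
  rewrite lt0r u0 andbT; apply: contraTneq lt => ->.
  by rewrite !mulr0 !mul0r ltxx.
rewrite -(ler_pM2l (mulr_gt0 eta_gt0 u_gt0)).
by move: (ltW lt); rewrite expr2; lra.
Qed.

(** By contraposition: a smaller star satisfies the link bound at some [y < x] whenever
    [eta * u > 0], and [y] is chosen so that this bound is exactly the failure of membership in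
    [A]. *)
Lemma star_good_ge v : v \in A -> (1 - eta) ^+ s * b <= d v.
Proof.
rewrite inE; apply: contraTT; rewrite -ltNge -leNgt => dlt.
have e1 : 0 <= 1 - eta by have := eta1; lra.
pose y := x - eta * u.
have yE : y - s.+1%:R = (1 - eta) * u by rewrite /y /u; ring.
have sy : s.+1%:R <= y by rewrite -subr_ge0 yE mulr_ge0.
have := @star_clique_le_of_small_star s _ E y v (@clique_boundP s) sy Es.
rewrite yE; apply; apply: lt_le_trans dlt _.
(* The required factor inequality has slack [eta * (s - i)]. *)
apply: ler_rbinom_scale => // i is_.
have : i%:R <= s%:R :> R by rewrite ler_nat ltnW.
have := eta_gt0; rewrite /y /u -natr1; nra.
Qed.

(** Combining membership in [A] with [k v <= #|E| - d v] gives [(1 - eta) * x * d v + eta * s.+1 * d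
    v < x * b]. *)
Lemma star_good_le v : v \in A -> (1 - eta) * d v <= b.
Proof.
rewrite inE -/u => vA.
have d0 : 0 <= d v by [].
have : s.+1%:R * k v <= s.+1%:R * (#|E|%:R - d v).
  by rewrite ler_wpM2l // natr_star_clique_le.
rewrite mulrBr Eb => kle.
rewrite -(ler_pM2l x0).
have : 0 <= eta * s.+1%:R * d v by rewrite !mulr_ge0 // ltW.
by have := lt_le_trans vA kle; rewrite /u; lra.
Qed.

Lemma card_good_le : (1 - eta) ^+ s * #|A|%:R <= x.
Proof.
rewrite -(ler_pM2r b0) -Eb -(sum_starR Es) (bigID (mem A)) /=.
rewrite mulrAC mulr_natr -sumr_const -[leLHS]addr0 lerD ?sumr_ge0 //.
by apply: ler_sum => v; apply: star_good_ge.
Qed.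

(** Guarantees that enough vertices exist to choose [S]: otherwise [#|E|] would exceed the number of
    [s.+1]-subsets of [T]. *)
Lemma x_le_card : x <= #|T|%:R.
Proof.
have EC : (#|E| <= 'C(#|T|, s.+1))%N.
  rewrite -card_draws; apply: subset_leq_card; apply/subsetP => e eE.
  by rewrite inE Es.
have E0 : (0 < #|E|)%N by rewrite -(ltr_nat R) Ex rbinom_gt0.
have sT : (s.+1 <= #|T|)%N by rewrite -bin_gt0 (leq_trans E0).
rewrite leNgt; apply/negP=> /(ltr_rbinom (k := s)).
by rewrite ler_nat sT rbinom_natr -Ex ltr_nat ltnNge EC => /(_ isT).
Qed.

Lemma almost_all_edges_in_set : exists2 S : {set T}, #|S|%:Z = Num.ceil x &
  #|[set e in E | ~~ (e \subset S)]|%:R <= 2 * s.+1%:R ^+ 2 * eta * #|E|%:R.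
Proof.
have [m mE] : exists m : nat, Num.ceil x = m%:Z.
  have : 0 <= Num.ceil x by rewrite ceil_ge0 (lt_trans _ x0) // ltrN10.
  by case: (Num.ceil x) => // m _; exists m.
have xm : x <= m%:R by have := ceil_ge x; rewrite mE.
have mT : (m <= #|T|)%N by rewrite -lez_nat -mE ceil_le_int x_le_card.
have [S Sm AS] := exists_comparable_set A mT.
exists S; first by rewrite Sm mE.
have M0 : 0 <= s.+1%:R * #|E|%:R :> R by rewrite mulr_ge0.
have lost : #|[set e in E | ~~ (e \subset S)]|%:R <= \sum_(v | v \notin S) d v.
  by rewrite -natr_sum ler_nat card_edges_not_subset_le.
apply: le_trans lost _.
(* The first term pays for vertices outside [A], the second for vertices of [A] cut off by [S]. The
   sum has coefficient [eta * s.+1 * (2 * s + 1)], below the claimed one. *)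
suff outside : \sum_(v | v \notin S) d v <=
    eta * (s.+1%:R * #|E|%:R) + 2 * s%:R * eta * (s.+1%:R * #|E|%:R).
  apply: le_trans outside _; rewrite -!natr1 in M0 *.
  have := mulr_ge0 (ltW eta_gt0) M0; lra.
case: AS => [SA|AS]; last first.
  apply: (@le_trans _ _ (\sum_(v | v \notin A) d v)).
    rewrite [leRHS](bigID [pred v | v \in S]) /= -[leLHS]add0r lerD ?sumr_ge0 //.
    rewrite le_eqVlt; apply/orP; left; apply/eqP; apply: eq_bigl => v.
    by case: (boolP (v \in S)); rewrite ?andbF // andbT => /(contra (subsetP AS v)) ->.
  apply: le_trans sum_star_bad _; rewrite lerDl.
  by rewrite !mulr_ge0 // ltW.
rewrite (bigID (mem A)) /= addrC lerD //.
  apply: le_trans sum_star_bad; rewrite le_eqVlt; apply/orP; left; apply/eqP.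
  apply: eq_bigl => v; case: (boolP (v \in A)); rewrite ?andbF // andbT.
  by move/(contra (subsetP SA v)).
set L := \sum_(_ | _) _.
have e1 : 0 < 1 - eta by have := eta1; lra.
(* At most [#|A| - x] good vertices are cut off, each of degree at most [b / (1 - eta)]. *)
have L1 : (1 - eta) * L <= (#|A|%:R - x) * b.
  apply: (@le_trans _ _ (#|A :\: S|%:R * b)).
    rewrite mulr_sumr mulr_natl -sumr_const.
    under [leRHS]eq_bigl => v do rewrite in_setD.
    by apply: ler_sum => v /andP[_]; apply: star_good_le.
  rewrite ler_pM2r // cardsD (setIidPr SA) natrB ?subset_leq_card // Sm.
  by rewrite lerB.
(* The extra factor [(1 - eta) ^+ s] lets [card_good_le] replace [#|A|] by [x]. *)
have L2 : (1 - eta) ^+ s.+1 * L <= (1 - (1 - eta) ^+ s) * (x * b).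
  rewrite exprSr -mulrA; apply: le_trans (ler_wpM2l (exprn_ge0 s (ltW e1)) L1) _.
  by rewrite [leLHS]mulrA [leRHS]mulrA ler_pM2r // mulrBr mulrBl mul1r lerB // card_good_le.
(* This lower bound is the source of the factor 2 in [outside]. *)
have B1 : 1 / 2 <= (1 - eta) ^+ s.+1.
  apply: le_trans (Bernoulli_sub1 _ (ltW eta_gt0) _); first by have := eta_small; lra.
  by have := eta1; lra.
have B2 : 1 - (1 - eta) ^+ s <= s%:R * eta.
  by have := @Bernoulli_sub1 _ eta s (ltW eta_gt0); lra.
have L0 : 0 <= L by rewrite sumr_ge0.
rewrite -Eb in L2.
have := ler_wpM2r L0 B1; have := ler_wpM2r M0 B2; lra.
Qed.

End Stability.
End CliqueBound.

Theorem theorem2 (R : realType) (eps : R) (r : nat)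
    (eps_gt0 : 0 < eps) (r_ge1 : (1 <= r)%N) :
  exists2 delta : R, 0 < delta &
    forall (G : uniform_hypergraph r) (x : R),
      r%:R <= x ->
      #|edges G|%:R = rbinom x r ->
      (1 - delta) * rbinom x r.+1 < #|cliques r.+1 G|%:R ->
      exists S : {set vertex G},
        #|S|%:Z = Num.ceil x /\
        #|[set e in edges G | ~~ (e \subset S)]|%:R <= eps * rbinom x r.
Proof.
case: r r_ge1 => // s _.
have s1 : 1 <= s.+1%:R :> R by rewrite ler1n.
(* The denominator cancels the loss constant of [almost_all_edges_in_set]; the minimum with 1
   secures [s.+1%:R * eta <= 1 / 2]. *)
pose eta : R := Num.min 1 eps / (2 * s.+1%:R ^+ 2).
have D0 : 0 < 2 * s.+1%:R ^+ 2 :> R by rewrite mulr_gt0 // exprn_gt0 // ltr0n.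
have m0 : 0 < Num.min 1 eps by rewrite lt_min ltr01.
have eta0 : 0 < eta by rewrite divr_gt0.
have etaE : 2 * s.+1%:R ^+ 2 * eta = Num.min 1 eps by rewrite /eta mulrC divfK // gt_eqF.
exists (eta ^+ 2); first by rewrite exprn_gt0.
move=> G x sx Ex many.
have small : s.+1%:R * eta <= 1 / 2.
  have : 2 * s.+1%:R ^+ 2 * eta <= 1 by rewrite etaE ge_min lexx.
  by nra.
have [S Sx lost] := almost_all_edges_in_set sx (@edges_card _ G) Ex eta0 small many.
exists S; split => //; apply: le_trans lost _.
by rewrite Ex etaE ler_wpM2r ?ge_min ?lexx ?orbT // ltW // rbinom_gt0.
Qed.
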